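(* Let $S\subset\mathbb{R}^n$ be a surface with band $B(S)$ (as in the context), and let $\operatorname{cp}:B(S)\to S$ be a closest point function. Then for every $m\ge 1$ and every continuously differentiable surface function $f:S\to\mathbb{R}^m$, the surface Jacobian $D_Sf$ satisfies $$D[f\circ \operatorname{cp}](y)=D_S f(y)\qquad\text{for all } y\in S,$$ where $D$ denotes the ordinary Jacobian in $\mathbb{R}^n$ of the map $f\circ\operatorname{cp}:B(S)\to\mathbb{R}^m$.
   Context: Surfaces. $S$ is an embedded $C^2$-submanifold of $\mathbb{R}^n$ without boundary (if there is a boundary, $S$ is identified with its interior), of dimension $k\le n$, possessing a tubular neighborhood $B(S)\subset\mathbb{R}^n$, an open set containing $S$, called a band around $S$. $S$ is orientable in the sense that, if $k<n$, there are smooth unit vector fields $N_1,\dots,N_{n-k}:S\to\mathbb{R}^n$ spanning the normal space $\mathcal{N}_yS$ at each $y\in S$. $\mathcal{T}_yS$ is the tangent space, and $P(y)\in\mathbb{R}^{n\times n}$ is the orthogonal projector of $\mathbb{R}^n$ onto $\mathcal{T}_yS$. Surface Jacobian. For a $C^1$ function $f:S\to\mathbb{R}^m$ and $y\in S$, let $f_E:\Omega_E\to\mathbb{R}^m$ be any $C^1$ extension of $f$ near $y$: $\Omega_E\subset\mathbb{R}^n$ is open, contains $y$, and $f_E=f$ on $S\cap\Omega_E$. Then $D_Sf(y):=Df_E(y)\cdot P(y)$ (independent of the chosen extension). Closest point function. A map $\operatorname{cp}:B(S)\to S$ is a closest point function if (1) it is a $C^1$-retraction, i.e. $\operatorname{cp}$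 is continuously differentiable (as a map into $\mathbb{R}^n$) and $\operatorname{cp}(y)=y$ for all $y\in S$; and (2) its Jacobian satisfies $D\operatorname{cp}(y)=P(y)$ for all $y\in S$. *)

(* Defs.v *)
From HB Require Import structures.
From mathcomp Require Import all_boot all_order all_algebra.
From mathcomp Require Import all_classical all_reals all_analysis.

Set Implicit Arguments.
Unset Strict Implicit.
Unset Printing Implicit Defensive.

Import Order.TTheory GRing.Theory Num.Theory.
Import numFieldNormedType.Exports.

Local Open Scope classical_set_scope.
Local Open Scope ring_scope.

(* Points of R^n are row vectors. Maps defined on a subset of R^n are
   represented by total functions that are constrained on that subset only. *)

(* The library norm on 'rV[R]_n is the sup norm, hence the Euclidean one here. *)
Definition edot (R : realType) (n : nat) (u v : 'rV[R]_n) : R :=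
  (u *m v^T) 0 0.

Definition enorm (R : realType) (n : nat) (v : 'rV[R]_n) : R :=
  Num.sqrt (edot v v).

(* The library's 'J f y acts on row vectors from the right and is n x m;
   its transpose is the usual m x n matrix of partial derivatives. *)
Definition Jac (R : realType) (n m : nat) (f : 'rV[R]_n -> 'rV[R]_m)
  (y : 'rV[R]_n) : 'M[R]_(m, n) := ('J f y)^T.

(* f is of class C^r on U; only meaningful for open U. *)
Fixpoint class_C (R : realType) (n m : nat) (r : nat) (U : set 'rV[R]_n)
  (f : 'rV[R]_n -> 'rV[R]_m) {struct r} : Prop :=
  if r is r'.+1 then
    (forall x, U x -> differentiable f x) /\
    (forall i : 'I_n, class_C r' U ('D_(delta_mx 0 i) f))
  else forall x, U x -> {for x, continuous f}.

(* [u *m pid_mx k] is the point (u, 0) of R^k x R^(n-k) = R^n. *)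
Definition slice_embed (R : realType) (n k : nat) (u : 'rV[R]_k) : 'rV[R]_n :=
  u *m pid_mx k.

(* Phi : U -> V is a C^2-diffeomorphism with inverse Psi that flattens S. *)
Definition slice_chart (R : realType) (n k : nat) (S U V : set 'rV[R]_n)
    (Phi Psi : 'rV[R]_n -> 'rV[R]_n) : Prop :=
  [/\ open U /\ open V,
      forall x, U x -> V (Phi x) /\ Psi (Phi x) = x,
      forall z, V z -> U (Psi z) /\ Phi (Psi z) = z,
      class_C 2 U Phi /\ class_C 2 V Psi &
      forall x, U x -> (S x <-> exists u : 'rV[R]_k, Phi x = slice_embed n u)].

Definition embedded_C2_submanifold (R : realType) (n k : nat)
    (S : set 'rV[R]_n) : Prop :=
  forall y, S y -> exists U V Phi Psi, U y /\ slice_chart k S U V Phi Psi.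

(* C^1 functions on the k-dimensional submanifold S, in local coordinates. *)
Definition surface_C1 (R : realType) (n k m : nat) (S : set 'rV[R]_n)
    (f : 'rV[R]_n -> 'rV[R]_m) : Prop :=
  forall y, S y -> exists U V Phi Psi,
    [/\ U y, slice_chart k S U V Phi Psi &
        class_C 1 [set u : 'rV[R]_k | V (slice_embed n u)]
                  (fun u => f (Psi (slice_embed n u)))].

(* Velocities at y of C^1 curves contained in S. *)
Definition tangent_space (R : realType) (n : nat) (S : set 'rV[R]_n)
    (y : 'rV[R]_n) : set 'rV[R]_n :=
  [set v | exists (e : R) (c : R -> 'rV[R]_n),
     [/\ 0 < e,
         forall t, `|t| < e ->
           [/\ S (c t), derivable c t 1 & {for t, continuous (derive1 c)}],
         c 0 = y & derive1 c 0 = v]].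

Definition normal_space (R : realType) (n : nat) (S : set 'rV[R]_n)
    (y : 'rV[R]_n) : set 'rV[R]_n :=
  [set v | forall w, tangent_space S y w -> edot v w = 0].

(* P acts on column vectors: [v *m P^T] is the transpose of [P *m v^T]. *)
Definition is_orthogonal_projector (R : realType) (n : nat)
    (T : set 'rV[R]_n) (P : 'M[R]_n) : Prop :=
  (forall v, T (v *m P^T)) /\
  (forall v w, T w -> edot (v - v *m P^T) w = 0).

(* The orthogonal projector onto a linear subspace is unique, so [get] selects
   it. *)
Definition tangent_projector (R : realType) (n : nat) (S : set 'rV[R]_n)
    (y : 'rV[R]_n) : 'M[R]_n :=
  get [set P : 'M[R]_n | is_orthogonal_projector (tangent_space S y) P].

(* A C^2 submanifold has in general only C^1 normal fields, whence the
   regularity required of the N i. *)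
Definition orientable (R : realType) (n k : nat) (S : set 'rV[R]_n) : Prop :=
  (k < n)%N -> exists N : 'I_(n - k) -> 'rV[R]_n -> 'rV[R]_n,
    [/\ forall i, surface_C1 k S (N i),
        forall i y, S y -> enorm (N i y) = 1 &
        forall y, S y -> forall v, normal_space S y v <->
          exists a : 'I_(n - k) -> R, v = \sum_i a i *: N i y].

(* (y, v) |-> y + v is a diffeomorphism from the set of the normal vectors v at
   points y of S such that |v| < delta y onto B; its inverse is
   x |-> (r x, x - r x). *)
Definition tubular_neighborhood (R : realType) (n : nat)
    (S B : set 'rV[R]_n) : Prop :=
  [/\ open B, S `<=` B &
      exists (delta : 'rV[R]_n -> R) (r : 'rV[R]_n -> 'rV[R]_n),
        [/\ {within S, continuous delta} /\ (forall y, S y -> 0 < delta y),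
            class_C 1 B r,
            forall x, B x -> [/\ S (r x), normal_space S (r x) (x - r x) &
                                 enorm (x - r x) < delta (r x)] &
            forall y v, S y -> normal_space S y v -> enorm v < delta y ->
              B (y + v) /\ r (y + v) = y]].

Definition surface_with_band (R : realType) (n k : nat)
    (S B : set 'rV[R]_n) : Prop :=
  [/\ (k <= n)%N, embedded_C2_submanifold k S, orientable k S &
      tubular_neighborhood S B].

Definition C1_extension_near (R : realType) (n m : nat) (S : set 'rV[R]_n)
    (f : 'rV[R]_n -> 'rV[R]_m) (y : 'rV[R]_n) (OmegaE : set 'rV[R]_n)
    (fE : 'rV[R]_n -> 'rV[R]_m) : Prop :=
  [/\ open OmegaE, OmegaE y, class_C 1 OmegaE fE &
      forall x, S x -> OmegaE x -> fE x = f x].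

(* The value does not depend on the extension, so [get] selects it. *)
Definition surface_jacobian (R : realType) (n m : nat) (S : set 'rV[R]_n)
    (f : 'rV[R]_n -> 'rV[R]_m) (y : 'rV[R]_n) : 'M[R]_(m, n) :=
  get [set A : 'M[R]_(m, n) | exists OmegaE fE,
         C1_extension_near S f y OmegaE fE /\
         A = Jac fE y *m tangent_projector S y].

Definition closest_point_function (R : realType) (n : nat)
    (S B : set 'rV[R]_n) (cp : 'rV[R]_n -> 'rV[R]_n) : Prop :=
  [/\ forall x, B x -> S (cp x),
      class_C 1 B cp,
      forall y, S y -> cp y = y &
      forall y, S y -> Jac cp y = tangent_projector S y].

(* Main.v *)
Require Import Defs.
From mathcomp Require Import all_boot all_order all_algebra.
From mathcomp Require Import all_classical all_reals all_analysis.
Import numFieldNormedType.Exports.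
Local Open Scope classical_set_scope.
Local Open Scope ring_scope.
Import GRing.Theory.

Set Implicit Arguments.
Unset Strict Implicit.

(** Any [C^1] extension [fE] of [f] near [y] satisfies [f \o cp = fE \o cp] near
    [y], because [cp] takes its values in [S]. The chain rule and
    [D cp y = P y] then give [D (f \o cp) y = D fE y * P y], whatever [fE] is;
    this yields both the theorem and the independence of [D_S f] of the
    extension. An extension exists: in a slice chart [Phi], compose [f] read in
    the chart with the linear projection of [Phi] onto the slice. *)

(** Differentiability is a first-order expansion at [x], hence local: the [o(h)] expansion of [f] is
    also one of [g]. *)
Lemma near_eq_is_diff (R : numFieldType) (V W : normedModType R)
    (f g df : V -> W) (x : V) :
  {near x, f =1 g} -> is_diff x f df -> is_diff x g df.
Proof.
move=> fg [fx <-].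
have gE : g \o shift x = cst (g x) + 'd f x +o_ 0 id.
  have /eqaddoP fE := diff_locally fx.
  apply/eqaddoP => e e0; move: (fE _ e0); apply: filter_app.
  have : \forall h \near (0 : V), f (h + x) = g (h + x).
    by have := near_shift 0 x [set z | f z = g z]; rewrite subr0 => <-.
  apply: filterS => h fgh.
  by rewrite !fctE /= fgh (nbhs_singleton fg).
(* Uniqueness of the linear part of the expansion identifies the differential of [g] before [g] is
   known to be differentiable. *)
have gx : 'd g x = 'd f x :> (V -> W).
  by apply: diff_unique => //; exact: diff_continuous.
split=> //; apply/diff_locallyP; rewrite gx; split=> //.
exact: diff_continuous.
Qed.

Lemma linear_rV_delta (R : numFieldType) n (W : normedModType R)
    (L : {linear 'rV[R]_n -> W}) (v : 'rV[R]_n) :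
  L v = \sum_j v 0 j *: L (delta_mx 0 j).
Proof.
rewrite {1}(row_sum_delta v) linear_sum.
by apply: eq_bigr => j _; rewrite linearZ.
Qed.

Lemma continuous_sum_at (R : numFieldType) (T : topologicalType)
    (W : normedModType R) (I : finType) (F : I -> T -> W) (x : T) :
  (forall i, {for x, continuous (F i)}) ->
  {for x, continuous (fun z => \sum_i F i z)}.
Proof.
by move=> Fc; apply: cvg_big => [|i _]; [exact: add_continuous|exact: Fc].
Qed.

Lemma continuous_rV_linear (R : numFieldType) n (W : normedModType R)
    (L : {linear 'rV[R]_n -> W}) : continuous L.
Proof.
move=> x; rewrite (funext (linear_rV_delta L)).
apply: continuous_sum_at => i; apply: continuousZr_tmp.
exact: coord_continuous.
Qed.

Lemma near_eq_continuous (T U : topologicalType) (f g : T -> U) (x : T) :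
  {near x, f =1 g} -> {for x, continuous f} -> {for x, continuous g}.
Proof.
move=> fg; rewrite /prop_for /continuous_at -(nbhs_singleton fg).
by apply: cvg_trans; exact: near_eq_cvg.
Qed.

Lemma class_C1_continuous (R : realType) n m (U : set 'rV[R]_n)
    (f : 'rV[R]_n -> 'rV[R]_m) (x : 'rV[R]_n) :
  class_C 1 U f -> U x -> {for x, continuous f}.
Proof. by move=> [fd _] /fd /differentiable_continuous. Qed.

Lemma class_C2_class_C1 (R : realType) n m (U : set 'rV[R]_n)
    (f : 'rV[R]_n -> 'rV[R]_m) : class_C 2 U f -> class_C 1 U f.
Proof.
move=> [fd Df]; split=> // i x Ux; exact: class_C1_continuous (Df i) Ux.
Qed.

Lemma class_C1_linear (R : realType) n m (U : set 'rV[R]_n)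
    (L : {linear 'rV[R]_n -> 'rV[R]_m}) : class_C 1 U L.
Proof.
have Lc := @continuous_rV_linear R n _ L.
split=> [x _|i x _]; first exact: linear_differentiable.
rewrite (_ : 'D_(delta_mx 0 i) L = cst (L (delta_mx 0 i))); last first.
  by apply/funext => z; rewrite deriveE ?diff_lin //; exact: linear_differentiable.
exact: cst_continuous.
Qed.

(** The map [h] is controlled only at points of [U], so the preimage of [W] is open only after
    intersection with [U]. *)
Lemma open_setI_preimage (T T' : topologicalType) (U : set T) (W : set T')
    (h : T -> T') :
  open U -> open W -> (forall x, U x -> {for x, continuous h}) ->
  open (U `&` h @^-1` W).
Proof.
move=> oU oW hc; rewrite openE => x [Ux Whx].
apply: filterI; first exact: open_nbhs_nbhs.
by apply: hc => //; exact: open_nbhs_nbhs.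
Qed.

Lemma class_C1_comp (R : realType) n p m (U : set 'rV[R]_n) (W : set 'rV[R]_p)
    (h : 'rV[R]_n -> 'rV[R]_p) (g : 'rV[R]_p -> 'rV[R]_m) :
  open U -> open W -> class_C 1 U h -> class_C 1 W g ->
  class_C 1 (U `&` h @^-1` W) (g \o h).
Proof.
move=> oU oW hC gC; have [hd Dh] := hC; have [gd Dg] := gC.
split=> [x [Ux Wx]|i x [Ux Wx]].
  by apply: differentiable_comp; [exact: hd|exact: gd].
(* Chain rule in coordinates: near [x], the [i]-th partial derivative of [g \o h] is this sum of
   products of continuous functions. *)
apply: (near_eq_continuous (f := fun z => \sum_j
    ('D_(delta_mx 0 i) h z) 0 j *: 'D_(delta_mx 0 j) g (h z))).
  have : nbhs x (U `&` h @^-1` W).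
    apply: open_nbhs_nbhs; split=> //.
    apply: (@open_setI_preimage _ _ U W h oU oW) => z.
    exact: class_C1_continuous hC.
  apply: filterS => z [Uz Wz].
  have dh := hd z Uz; have dg := gd _ Wz.
  rewrite (deriveE _ (differentiable_comp dh dg)) diff_comp // /=.
  rewrite linear_rV_delta -deriveE //.
  by apply: eq_bigr => j _; rewrite -[in RHS]deriveE.
apply: continuous_sum_at => j; apply: continuousZ.
  apply: (@continuous_comp _ _ _ ('D_(delta_mx 0 i) h)
    (fun v : 'rV[R]_p => v 0 j)); first exact: (Dh i x Ux).
  exact: coord_continuous.
apply: (@continuous_comp _ _ _ h ('D_(delta_mx 0 j) g)); first last.
  exact: (Dg j _ Wx).
exact: class_C1_continuous hC Ux.
Qed.

Lemma eq_diff_Jac (R : realType) n m (f g : 'rV[R]_n -> 'rV[R]_m)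
    (x x' : 'rV[R]_n) :
  'd f x = 'd g x' :> ('rV[R]_n -> 'rV[R]_m) -> Jac f x = Jac g x'.
Proof. by move=> /(congr1 (fun d => (lin1_mx d)^T)); apply. Qed.

(** Matrices acting on row vectors compose from left to right; the transpose in [Jac] restores the
    usual order. *)
Lemma Jac_comp (R : realType) n p m (h : 'rV[R]_n -> 'rV[R]_p)
    (g : 'rV[R]_p -> 'rV[R]_m) (x : 'rV[R]_n) :
  differentiable h x -> differentiable g (h x) ->
  Jac (g \o h) x = Jac g (h x) *m Jac h x.
Proof.
move=> dh dg; rewrite /Jac -trmx_mul; congr trmx.
apply/row_matrixP => i; rewrite !rowE mulmxA /jacobian !mul_rV_lin1.
by rewrite diff_comp.
Qed.

Lemma slice_embedK (R : realType) n k (u : 'rV[R]_k) :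
  (k <= n)%N -> slice_embed n u *m pid_mx k = u.
Proof.
by move=> kn; rewrite /slice_embed -mulmxA mul_pid_mx minnn (minn_idPr kn)
  pid_mx_1 mulmx1.
Qed.

Lemma surface_C1_extension (R : realType) n k m (S : set 'rV[R]_n)
    (f : 'rV[R]_n -> 'rV[R]_m) (y : 'rV[R]_n) :
  (k <= n)%N -> surface_C1 k S f -> S y ->
  exists OmegaE fE, C1_extension_near S f y OmegaE fE.
Proof.
move=> kn fC Sy.
have [U [V [Phi [Psi [Uy [[oU oV] PhiK _ [PhiC _] SE] gC]]]]] := fC y Sy.
pose W := [set u : 'rV[R]_k | V (slice_embed n u)].
(* The two [pid_mx k] have different sizes: [L] keeps the first [k] coordinates, while [E] is the
   inclusion of the slice. *)
pose L : {linear 'rV[R]_n -> 'rV[R]_k} := mulmxr (pid_mx k).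
pose E : {linear 'rV[R]_k -> 'rV[R]_n} := mulmxr (pid_mx k).
have oW : open W.
  by apply: (open_comp (f := E)) => // u _; exact: continuous_rV_linear.
have LC : class_C 1 (U `&` Phi @^-1` setT) (L \o Phi).
  apply: class_C1_comp => //; first exact: openT.
  - exact: class_C2_class_C1.
  - exact: class_C1_linear.
rewrite preimage_setT setIT in LC.
(* Points of [S] are sent by [Phi] into the slice, where projecting and embedding again changes
   nothing. *)
have LPhi x : S x -> U x -> slice_embed n (L (Phi x)) = Phi x.
  by move=> Sx Ux; have [u ->] := (SE x Ux).1 Sx; rewrite /L /= slice_embedK.
(* Off [S], the projection of a point of [V] onto the slice may leave [V], so [U] is shrunk to the
   points whose projection stays in [V]. *)
exists (U `&` (L \o Phi) @^-1` W).
exists ((fun u => f (Psi (slice_embed n u))) \o (L \o Phi)); split.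
- apply: (@open_setI_preimage _ _ U W (L \o Phi) oU oW) => x.
  exact: class_C1_continuous LC.
- by split=> //; rewrite /W /= LPhi //; exact: (PhiK y Uy).1.
- exact: class_C1_comp.
- by move=> x Sx [Ux _]; rewrite /= LPhi // (PhiK x Ux).2.
Qed.

Lemma Jac_comp_extension (R : realType) n m (S B : set 'rV[R]_n)
    (cp : 'rV[R]_n -> 'rV[R]_n) (f : 'rV[R]_n -> 'rV[R]_m) (y : 'rV[R]_n)
    (OmegaE : set 'rV[R]_n) (fE : 'rV[R]_n -> 'rV[R]_m) :
  open B -> B y -> S y -> closest_point_function S B cp ->
  C1_extension_near S f y OmegaE fE ->
  differentiable (f \o cp) y /\
  Jac (f \o cp) y = Jac fE y *m tangent_projector S y.
Proof.
move=> oB By Sy [cpS cpC cpK Jcp] [oO Oy [fEd _] fEf].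
have dcp : differentiable cp y by exact: cpC.1.
have dfE : differentiable fE (cp y) by rewrite cpK //; exact: fEd.
(* The equality holds on an open set around [y], not just on [S]: there [cp] lands in both [S] and
   [OmegaE], where [fE] and [f] agree. *)
have near_fE : {near y, fE \o cp =1 f \o cp}.
  have : nbhs y (B `&` cp @^-1` OmegaE).
    apply: open_nbhs_nbhs; split; last by split=> //; rewrite /= cpK.
    apply: (@open_setI_preimage _ _ B OmegaE cp oB oO) => x.
    exact: class_C1_continuous cpC.
  by apply: filterS => x [Bx Ox]; apply: fEf => //; exact: cpS.
have [dfcp fcpE] := near_eq_is_diff near_fE
  (differentiableP (differentiable_comp dcp dfE)).
split; first exact: dfcp.
by rewrite (eq_diff_Jac fcpE) (Jac_comp dcp dfE)
  (cpK y Sy) (Jcp y Sy).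
Qed.

Unset Implicit Arguments.
Set Strict Implicit.

Theorem theorem3p2 (R : realType) (n k : nat) (S B : set 'rV[R]_n)
    (cp : 'rV[R]_n -> 'rV[R]_n) :
  surface_with_band k S B -> closest_point_function S B cp ->
  forall (m : nat) (f : 'rV[R]_n -> 'rV[R]_m),
    (1 <= m)%N -> surface_C1 k S f ->
    forall y, S y ->
      differentiable (f \o cp) y /\
      Jac (f \o cp) y = surface_jacobian S f y.
Proof.
move=> [kn _ _ [oB SB _]] cpP m f _ fC y Sy.
have extJ OmegaE fE := @Jac_comp_extension R n m S B cp f y OmegaE fE
  oB (SB y Sy) Sy cpP.
have [OmegaE [fE extE]] := surface_C1_extension kn fC Sy.
split; first exact: (extJ _ _ extE).1.
(* The extension behind the value selected by [get] need not be the one constructed above; [extJ]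
   applies to it all the same. *)
have [|O' [fE' [ext' jacE]]] := @getPex _ [set A : 'M[R]_(m, n) |
    exists OmegaE fE, C1_extension_near S f y OmegaE fE /\
    A = Jac fE y *m tangent_projector S y].
  by exists (Jac fE y *m tangent_projector S y), OmegaE, fE.
by rewrite (extJ _ _ ext').2; exact: esym jacE.
Qed.
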